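(* Let $N\ge2$, $R>0$, and let $0<\alpha_1\le\alpha_2\le\dots\le\alpha_N$ satisfy $$\frac{1}{\alpha_1^2}>\frac{3}{\alpha_2^2}+\sum_{i=3}^N\frac{1}{\alpha_i^2}$$ (for $N=2$ the sum is empty, so the condition reads $\alpha_2^2>3\alpha_1^2$). Let $A=\mathrm{Rect}(\alpha_1,\alpha_2,\alpha_3,\dots,\alpha_N)$ and $B=\mathrm{Rect}(\alpha_2,\alpha_1,\alpha_3,\dots,\alpha_N)$, and for $x\in\mathbb{R}^N$ let $B_x=x+B$. Then $$\inf_{x\in\mathbb{R}^N}\mu_1^+(A\cap B_x)>\mu_1^+(A)+\mu_1^+(B).$$ In particular, the inequality $\inf_{x\in\mathbb{R}^N}\mu_1^+(A\cap B_x)<\mu_1^+(A)+\mu_1^+(B)$ is not true in general for bounded domains $A,B\subset\mathbb{R}^N$.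
   Context: For $\alpha=(\alpha_1,\dots,\alpha_N)$ with $\alpha_i>0$, $\mathrm{Rect}(\alpha)=\prod_{i=1}^N(-\alpha_i^{-1}R,\alpha_i^{-1}R)$. For a symmetric real $N\times N$ matrix $X$, $\mathcal{P}^+_1(X)=\lambda_N(X)$ denotes its largest eigenvalue. For a bounded domain $\Omega\subset\mathbb{R}^N$, the principal eigenvalue of $\mathcal{P}^+_1$ in $\Omega$ is $$\mu_1^+(\Omega)=\sup\{\mu\in\mathbb{R} : \exists\, \phi>0 \text{ in } \Omega,\ \mathcal{P}^+_1(D^2\phi)+\mu\phi\le 0 \text{ in }\Omega\},$$ where $\phi$ is lower semicontinuous and the inequality is understood in the viscosity sense. By convention $\mu_1^+(\emptyset)=+\infty$. *)

(* Defs.v *)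
From HB Require Import structures.
From mathcomp Require Import all_boot all_order all_algebra.
From mathcomp Require Import all_classical all_reals all_analysis.

Set Implicit Arguments.
Unset Strict Implicit.
Unset Printing Implicit Defensive.

Import Order.TTheory GRing.Theory Num.Theory.
Import numFieldNormedType.Exports.

Local Open Scope classical_set_scope.
Local Open Scope ring_scope.

(* Points of R^N are row vectors, with the max norm of the library; topology
   and boundedness are those of the Euclidean norm. *)

Section Defs.
Context {R : realType} {N : nat}.
Implicit Types (O : set 'rV[R]_N) (f phi psi : 'rV[R]_N -> R).

Definition partial (i : 'I_N) f (x : 'rV[R]_N) : R := 'D_('e_i) f x.

Definition hessian f (x : 'rV[R]_N) : 'M[R]_N :=
  \matrix_(i, j) partial i (partial j f) x.

(* f is of class C^2 on the open set O. *)
Definition C2_on O f : Prop := forall x, O x ->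
  [/\ {for x, continuous f},
      forall i, derivable f x 'e_i /\
                {for x, continuous (partial i f)} &
      forall i j, derivable (partial j f) x 'e_i /\
                  {for x, continuous (partial i (partial j f))}].

(* The spectrum of a matrix is finite, and that of a real symmetric matrix of
   size N > 0 is nonempty: on these the supremum is the largest eigenvalue. *)
Definition P1plus (X : 'M[R]_N) : R := sup [set a : R | eigenvalue X a].

(* phi satisfies P1plus (D^2 phi) + mu phi <= 0 in the open set O in the
   viscosity sense: test functions touch phi from below, up to a constant. *)
Definition viscosity_supersolution (mu : R) O phi : Prop :=
  forall psi, C2_on O psi ->
  forall x0, O x0 ->
    (\forall x \near x0, phi x0 - psi x0 <= phi x - psi x) ->
    P1plus (hessian psi x0) + mu * phi x0 <= 0.

(* Only the values of phi on O matter: points outside O are isolated in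
   [subspace O], so that semicontinuity is that of the restriction to O. *)
Definition lsc_on O phi : Prop :=
  lower_semicontinuous (fun x : subspace O => (phi x)%:E).

Definition mu1plus O : \bar R :=
  ereal_sup [set mu%:E | mu in [set mu : R | exists phi,
    [/\ lsc_on O phi,
        forall x, O x -> 0 < phi x &
        viscosity_supersolution mu O phi]]].

Definition Rect (rho : R) (alpha : 'I_N -> R) : set 'rV[R]_N :=
  [set x | forall i, - ((alpha i)^-1 * rho) < x 0 i < (alpha i)^-1 * rho].

Definition translate (x : 'rV[R]_N) (B : set 'rV[R]_N) : set 'rV[R]_N :=
  [set x + y | y in B].

Definition bounded_domain O : Prop :=
  [/\ O !=set0, open O, connected O & bounded_set O].

(* The convention mu1plus(set0) = +oo is an instance of the definition. *)
Lemma mu1plus_set0 : mu1plus set0 = +oo%E.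
Proof.
apply: eq_infty => r; apply: ereal_sup_ubound; exists r => //.
exists (fun=> 1); split=> // x a a1; exists setT => //; exact: filterT.
Qed.

End Defs.

Definition ord_1 {n : nat} : 'I_n.+2 := @Ordinal n.+2 1 isT.

(* Main.v *)
Require Import Defs.
From HB Require Import structures.
From mathcomp Require Import all_boot all_order all_algebra perm ring lra.
From mathcomp Require Import all_classical all_reals all_analysis.

(* For the box with half-lengths b_i one has mu1plus = pi^2 / (4 |b|^2); each
   rectangle needs the upper bound and each intersection the lower bound.
   Upper bound: in a thin tube around the diagonal (-s b, s b), s < 1, the
   product of a cosine along the axis and a parabola across it can be slid under
   any positive supersolution until it touches; by the Rayleigh quotient, its
   second derivative along b at the contact point bounds P1plus from below.
   Lower bound: the box lies in a ball of radius r = |b|, where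
   cos (pi |x - c| / (2 r)) is a supersolution, since restricted to a unit-speed
   line its second derivative is at most - (pi / (2 r))^2 times itself.
   A and B have the same half-diagonal, whereas A `&` translate x B lies in a box
   in which the longest half-length is replaced by the second one; the
   hypothesis says exactly that the squared half-diagonal of this box is less
   than half that of A. *)

Set Implicit Arguments.
Unset Strict Implicit.
Unset Printing Implicit Defensive.

Import Order.TTheory GRing.Theory Num.Theory.
Import numFieldNormedType.Exports.

Local Open Scope classical_set_scope.
Local Open Scope ring_scope.

(** * Directional derivatives of functions with continuous partial derivatives *)

Lemma is_derive_lineP (R : realType) (N : nat) (f : 'rV[R]_N -> R) (x v : 'rV[R]_N)
    (t d : R) :
  is_derive (x + t *: v) v f d <-> is_derive t (1 : R) (fun s : R => f (x + s *: v)) d.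
Proof.
have E : (fun h : R => h^-1 *: ((f \o shift (x + t *: v)) (h *: v) - f (x + t *: v))) =
    (fun h : R => h^-1 *: (((fun s : R => f (x + s *: v)) \o shift t) (h *: (1 : R)) -
       f (x + t *: v))).
  apply/funext => h /=; congr (_ *: (f _ - _)).
  by rewrite /shift /= scalerDl [h%:A]mulr1 addrCA addrA.
by split=> -[fd <-]; split; (try by move: fd; rewrite /derivable E);
  rewrite /derive E.
Qed.

Lemma norm_delta_le1 (R : realType) (N : nat) (i : 'I_N) : `|'e_i : 'rV[R]_N| <= 1.
Proof.
rewrite [leLHS]/Num.norm /= mx_normrE; apply/bigmax_leP; split => // -[a b] _ /=.
by rewrite mxE; case: (_ && _); rewrite ?normr1 ?normr0.
Qed.

Section C1.
Context {R : realType} {N : nat}.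
Implicit Types (f : 'rV[R]_N -> R) (x v : 'rV[R]_N).

(** The segment is parametrized by s in [0, 1], so that u may have either sign. *)
Lemma MVT_coord f x (i : 'I_N) (u : R) :
  (forall s : R, 0 <= s <= 1 -> derivable f (x + (s * u) *: 'e_i) 'e_i) ->
  exists2 s : R, 0 <= s <= 1 & f (x + u *: 'e_i) - f x = u * partial i f (x + (s * u) *: 'e_i).
Proof.
move=> df.
have dg (s : R) : 0 <= s <= 1 ->
    is_derive s (1 : R) (fun s : R => f (x + (s * u) *: 'e_i))
      (partial i f (x + (s * u) *: 'e_i) * u).
  move=> /df/derivableP/is_derive_lineP d1.
  have d2 : is_derive s (1 : R) (fun s : R => s * u) u.
    by apply: (is_derive_eq (is_deriveM _ _)); rewrite scaler0 add0r [_%:A]mulr1.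
  exact: (@is_derive1_comp _ (fun r : R => f (x + r *: 'e_i)) (fun s => s * u)).
have [|||c] := @MVT_segment R (fun s : R => f (x + (s * u) *: 'e_i))
   (fun s => partial i f (x + (s * u) *: 'e_i) * u) 0 1.
- exact: ler01.
- by move=> s; rewrite in_itv /= => /andP[s0 s1]; apply: dg; rewrite !ltW.
- apply: derivable_within_continuous => s; rewrite in_itv /= => /dg.
  by case.
rewrite in_itv /= => c01; rewrite mul1r mul0r scale0r addr0 subr0 mulr1 => ->.
by exists c => //; rewrite mulrC.
Qed.

(** The coordinates are changed one at a time, by induction on the list. Each change is an instance
    of [MVT_coord], and its intermediate point stays within [del] of x because the unit vectors have
    norm at most 1. *)
Lemma C1_increment f x (e del : R) :
  (forall y, `|y - x| < del -> forall i, derivable f y 'e_i) ->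
  (forall y, `|y - x| < del -> forall i, `|partial i f y - partial i f x| <= e) ->
  forall (u : 'I_N -> R) (s : seq 'I_N), \sum_(i <- s) `|u i| < del ->
  `|f (x + \sum_(i <- s) u i *: 'e_i) - f x - \sum_(i <- s) u i * partial i f x|
    <= e * \sum_(i <- s) `|u i|.
Proof.
move=> df cf u; elim=> [|i s IH].
  by rewrite !big_nil addr0 subrr subr0 mulr0 normr0.
rewrite !big_cons => us.
have bnd : `|\sum_(j <- s) u j *: 'e_j : 'rV[R]_N| <= \sum_(j <- s) `|u j|.
  apply: (le_trans (ler_norm_sum _ _ _)); apply: ler_sum => j _.
  by rewrite normrZ ler_piMr// norm_delta_le1.
have near (c : R) : 0 <= c <= 1 ->
    `|x + \sum_(j <- s) u j *: 'e_j + (c * u i) *: 'e_i - x| < del.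
  move=> /andP[c0 c1]; rewrite addrAC (addrAC x) subrr add0r.
  apply: le_lt_trans us; rewrite [leRHS]addrC; apply: (le_trans (ler_normD _ _)).
  apply: lerD => //; rewrite normrZ normrM (ger0_norm c0) -mulrA.
  rewrite -[leRHS]mul1r; apply: ler_pM => //.
  by rewrite ler_piMr// norm_delta_le1.
have [|c /[dup] c01 /near cx] :=
    @MVT_coord f (x + \sum_(j <- s) u j *: 'e_j) i (u i).
  by move=> c /near cx; exact: df.
have -> : x + (u i *: 'e_i + \sum_(j <- s) u j *: 'e_j) =
   x + \sum_(j <- s) u j *: 'e_j + u i *: 'e_i by rewrite addrA addrAC.
set y := x + _ in cx *; set z := _ + _ *: _ in cx * => E.
have -> : f (y + u i *: 'e_i) - f x -
   (u i * partial i f x + \sum_(j <- s) u j * partial j f x) =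
   u i * (partial i f z - partial i f x) +
   (f y - f x - \sum_(j <- s) u j * partial j f x).
  by rewrite mulrBr -E; ring.
rewrite [leRHS]mulrDr; apply: (le_trans (ler_normD _ _)); apply: lerD.
  by rewrite normrM mulrC ler_wpM2r// cf.
by apply: IH; apply: le_lt_trans us; rewrite lerDr.
Qed.

(** [C2_on] only provides derivatives along the coordinate axes. This lemma recovers those in every
    direction, so that test functions can be restricted to arbitrary lines. *)
Lemma C1_is_derive f x v :
  (\forall y \near x, forall i, derivable f y 'e_i) ->
  (forall i, {for x, continuous (partial i f)}) ->
  is_derive x v f (\sum_i v 0 i * partial i f x).
Proof.
move=> df cf.
have lim : (fun h : R => h^-1 *: ((f \o shift x) (h *: v) - f x)) @ 0^' -->
    (\sum_i v 0 i * partial i f x : R).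
  apply/cvgrPdist_le => e e0.
  set S := \sum_i `|v 0 i|.
  have S0 : 0 <= S by apply: sumr_ge0 => i _; exact: normr_ge0.
  (* The summand 1 covers v = 0, where S vanishes; in all cases e' * S <= e. *)
  pose e' := e / (S + 1).
  have e'0 : 0 < e' by rewrite divr_gt0// ltr_wpDl.
  have : \forall y \near x, (forall i, derivable f y 'e_i) /\
      (forall i, `|partial i f y - partial i f x| <= e').
    apply: (filterI df).
    refine (@filter_forall _ 'I_N (fun i y => `|partial i f y - partial i f x| <= e')
      _ (nbhs_filter x) _) => i.
    have /cvgrPdist_le/(_ _ e'0) := cf i.
    by apply: filterS => y; rewrite distrC.
  move=> /nbhs_ballP[del /= del0 xdel].
  have {}xdel y : `|y - x| < del -> (forall i, derivable f y 'e_i) /\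
      (forall i, `|partial i f y - partial i f x| <= e').
    by move=> yx; apply: xdel; rewrite -ball_normE /= distrC.
  have key (h : R) : h != 0 -> `|h| * S < del ->
      `|\sum_i v 0 i * partial i f x - h^-1 *: ((f \o shift x) (h *: v) - f x)| <= e.
    move=> h0 hS.
    have Sh : \sum_i `|h * v 0 i| = `|h| * S.
      by rewrite mulr_sumr; apply: eq_bigr => i _; rewrite normrM.
    have := @C1_increment f x e' del (fun y yx => (xdel y yx).1)
      (fun y yx => (xdel y yx).2) (fun i => h * v 0 i) (index_enum 'I_N).
    rewrite Sh => /(_ hS).
    have -> : \sum_i (h * v 0 i) *: 'e_i = h *: v.
      rewrite [in RHS](row_sum_delta v) scaler_sumr.
      by apply: eq_bigr => i _; rewrite scalerA.
    have -> : \sum_i h * v 0 i * partial i f x = h * \sum_i v 0 i * partial i f x.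
      by rewrite mulr_sumr; apply: eq_bigr => i _; rewrite mulrA.
    rewrite /= /shift (addrC (h *: v)) => H.
    have -> : \sum_i v 0 i * partial i f x - h^-1 *: (f (x + h *: v) - f x) =
       - (h^-1 * (f (x + h *: v) - f x - h * (\sum_i v 0 i * partial i f x))).
      rewrite mulrBr mulrA mulVf// mul1r opprB.
      by congr (_ - _).
    rewrite normrN normrM normfV mulrC ler_pdivrMr ?normr_gt0//.
    apply: (le_trans H); rewrite mulrCA mulrC ler_wpM2r//.
    by rewrite /e' -mulrA ler_piMr ?(ltW e0)// mulrC ler_pdivrMr ?mul1r ?lerDl// ltr_wpDl.
  near=> h; apply: key; first by near: h; exact: nbhs_dnbhs_neq.
  have : `|h| < del / (S + 1).
    by near: h; apply: dnbhs0_lt; rewrite divr_gt0// ltr_wpDl.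
  rewrite ltr_pdivlMr ?ltr_wpDl//; apply: le_lt_trans.
  by rewrite ler_wpM2l// lerDl.
split; first by apply/cvg_ex; eexists; exact: lim.
by rewrite /derive; exact: cvg_lim lim.
Unshelve. all: by end_near. Qed.

End C1.

(** * Second derivatives along lines and symmetry of the Hessian *)

Section second_order.
Context {R : realType}.

(** Minimality gives G 0 = 0, hence G h / h tends to q. If q were negative, G would be negative just
    to the right of 0, and the mean value theorem would give g t < g 0 for a small t > 0. *)
Lemma second_derivative_test (g G : R -> R) (q : R) :
  (\forall t \near (0 : R), is_derive t (1 : R) g (G t)) ->
  is_derive (0 : R) (1 : R) G q ->
  (\forall t \near (0 : R), g 0 <= g t) -> 0 <= q.
Proof.
move=> dg dG gmin; rewrite leNgt; apply/negP => q0.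
have : \forall t \near (0 : R), is_derive t (1 : R) g (G t) /\ g 0 <= g t.
  exact: filterI.
move=> /nbhs_ballP[d /= d0 Hd].
have {}Hd (t : R) : `|t| < d -> is_derive t (1 : R) g (G t) /\ g 0 <= g t.
  by move=> td; apply: Hd; rewrite -ball_normE /= sub0r normrN.
have G0 : G 0 = 0.
  have [||||] := @derive1_at_min R g (- (d / 2)) (d / 2) 0.
  - by lra.
  - move=> t; rewrite in_itv /= => /andP[t1 t2].
    by have [[]] : is_derive t (1 : R) g (G t) /\ g 0 <= g t; first
      by apply: Hd; rewrite ltr_norml; lra.
  - by rewrite in_itv /=; lra.
  - move=> t; rewrite in_itv /= => /andP[t1 t2].
    by apply: (Hd t _).2; rewrite ltr_norml; lra.
  have [[_ <-] _] := Hd 0 ltac:(by rewrite normr0).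
  by move=> _ ->.
have lim : (fun h : R => h^-1 * G h) @ 0^' --> q.
  case: dG => + <-; rewrite /derivable /derive /= => /cvgP.
  rewrite (_ : (fun h : R => _) = fun h : R => h^-1 * G h) //.
  by apply/funext => h; rewrite /shift /= [h%:A]mulr1 addr0 G0 subr0.
have /nbhs_ballP[d' /= d'0 Hd'] : \forall h \near (0 : R)^', h^-1 * G h < 0.
  by apply: (cvgr_lt q) => //.
pose t := Num.min (d / 2) (d' / 2).
have t0 : 0 < t by rewrite lt_min; apply/andP; split; lra.
have td : t < d by rewrite gt_min; apply/orP; left; lra.
have td' : t < d' by rewrite gt_min; apply/orP; right; lra.
have [|||c] := @MVT R g G 0 t => //.
- move=> s; rewrite in_itv /= => /andP[s1 s2].
  by apply: (Hd s _).1; rewrite ltr_norml; lra.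
- apply: derivable_within_continuous => s; rewrite in_itv /= => /andP[s1 s2].
  by have [[]] := Hd s ltac:(rewrite ltr_norml; lra).
rewrite in_itv /= => /andP[c0 ct] E.
have : G c < 0.
  have : c^-1 * G c < 0.
    apply: Hd'; last by rewrite gt_eqF.
    by rewrite -ball_normE /= sub0r normrN ltr_norml; lra.
  by rewrite pmulr_rlt0// invr_gt0.
have : g 0 <= g t by apply: (Hd t _).2; rewrite ltr_norml; lra.
rewrite -subr_ge0 E subr0 pmulr_lge0// leNgt; exact/negP.
Qed.

Context {N : nat}.
Implicit Types (f psi : 'rV[R]_N -> R) (x v : 'rV[R]_N) (O : set 'rV[R]_N).

Definition qform (H : 'M[R]_N) v : R := (v *m H *m v^T) 0 0.

Lemma near_line O x v : open O -> O x -> \forall t \near (0 : R), O (x + t *: v).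
Proof.
move=> oO Ox.
have : (fun t : R => x + t *: v) @ (0 : R) --> x + (0 : R) *: v.
  apply: cvgD; first exact: cvg_cst.
  by apply: cvgZr_tmp; exact: cvg_id.
by apply; rewrite scale0r addr0; exact: open_nbhs_nbhs.
Qed.

(** [C1_is_derive] is used twice, on psi near x and then on each of its partial derivatives at x.
    The two conclusions have the form that [second_derivative_test] expects. *)
Lemma C2_line O psi x v : open O -> C2_on O psi -> O x ->
  (\forall t \near (0 : R), is_derive t (1 : R) (fun s : R => psi (x + s *: v))
     (\sum_i v 0 i * partial i psi (x + t *: v))) /\
  is_derive (0 : R) (1 : R)
    (fun t : R => \sum_i v 0 i * partial i psi (x + t *: v)) (qform (hessian psi x) v).
Proof.
move=> oO C2 Ox.
have nO y : O y -> \forall z \near y, O z.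
  by move=> Oy; exact: open_nbhs_nbhs.
split.
  have := near_line v oO Ox; apply: filterS => t Ot.
  apply/is_derive_lineP; apply: C1_is_derive.
    by apply: filterS (nO _ Ot) => y /C2[_ + _] i => /(_ i)[].
  by move=> i; have [_ /(_ i)[]] := C2 _ Ot.
have -> : qform (hessian psi x) v =
    \sum_i v 0 i * (\sum_j v 0 j * partial j (partial i psi) x).
  rewrite /qform !mxE; apply: eq_bigr => i _; rewrite !mxE mulrC; congr (_ * _).
  by apply: eq_bigr => j _; rewrite !mxE.
have -> : (fun t : R => \sum_i v 0 i * partial i psi (x + t *: v)) =
   \sum_i (fun t : R => v 0 i * partial i psi (x + t *: v)).
  by apply/funext => t; rewrite fct_sumE.
apply: is_derive_sum => i.
apply: is_deriveZ; apply/is_derive_lineP; rewrite scale0r addr0.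
apply: C1_is_derive.
  by apply: filterS (nO _ Ox) => y /C2[_ _ +] j => /(_ j i)[].
by move=> j; have [_ _ /(_ j i)[]] := C2 _ Ox.
Qed.

Lemma is_derive_translate f x v w d :
  is_derive (x + w) v f d -> is_derive x v (fun y => f (y + w)) d.
Proof.
have E : (fun h : R => h^-1 *: ((f \o shift (x + w)) (h *: v) - f (x + w))) =
    (fun h : R => h^-1 *: (((fun y => f (y + w)) \o shift x) (h *: v) - f (x + w))).
  by apply/funext => h /=; rewrite /shift /= addrA.
case=> fd <-; split; first by move: fd; rewrite /derivable E.
by rewrite /derive E.
Qed.

(** The mean value theorem is applied along ['e_i] to y |-> f (y + h e_j) - f y, and then along
    ['e_j] to the i-th partial derivative of f. *)
Lemma second_difference f x (i j : 'I_N) (h del : R) : `|h| + `|h| < del ->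
  (forall y, `|y - x| < del ->
     derivable f y 'e_i /\ derivable (partial i f) y 'e_j) ->
  exists2 y, `|y - x| < del &
    f (x + h *: 'e_i + h *: 'e_j) - f (x + h *: 'e_i) - (f (x + h *: 'e_j) - f x) =
    h * (h * partial j (partial i f) y).
Proof.
move=> hdel df.
have le1 (s : R) k : 0 <= s <= 1 -> `|(s * h) *: 'e_k : 'rV[R]_N| <= `|h|.
  move=> /andP[s0 s1]; rewrite normrZ normrM (ger0_norm s0) -mulrA.
  by rewrite -[leRHS]mul1r; apply: ler_pM => //; rewrite ler_piMr// norm_delta_le1.
have bnd (s s' : R) : 0 <= s <= 1 -> 0 <= s' <= 1 ->
    `|x + (s * h) *: 'e_i + (s' * h) *: 'e_j - x| < del.
  move=> s01 s'01; rewrite addrAC (addrAC x) subrr add0r.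
  apply: le_lt_trans hdel; apply: (le_trans (ler_normD _ _)).
  by apply: lerD; exact: le1.
have s00 : 0 <= (0 : R) <= 1 by rewrite lexx ler01.
have s11 : 0 <= (1 : R) <= 1 by rewrite lexx ler01.
pose g y := f (y + h *: 'e_j) - f y.
have dg (s : R) : 0 <= s <= 1 -> is_derive (x + (s * h) *: 'e_i) 'e_i g
    (partial i f (x + (s * h) *: 'e_i + h *: 'e_j) - partial i f (x + (s * h) *: 'e_i)).
  move=> s01; apply: is_deriveB.
    apply: is_derive_translate; apply: derivableP.
    by have := bnd _ _ s01 s11; rewrite mul1r => /df[].
  apply: derivableP.
  by have := bnd _ _ s01 s00; rewrite mul0r scale0r addr0 => /df[].
have [|s s01 E1] := @MVT_coord R N g x i h.
  by move=> s /dg[].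
have [|s' s'01 E2] := @MVT_coord R N (partial i f) (x + (s * h) *: 'e_i) j h.
  by move=> s' s'01; have /df[] := bnd _ _ s01 s'01.
exists (x + (s * h) *: 'e_i + (s' * h) *: 'e_j); first exact: bnd.
rewrite -E2; move: E1; rewrite /g => ->; congr (_ * _).
by have [_ <-] := dg _ s01.
Qed.

(** Schwarz's theorem: the second difference is symmetric in i and j, so the two mixed derivatives
    agree at some points y and z close to x, and by continuity they differ at x by at most any e >
    0. *)
Lemma hessian_sym O f x : open O -> C2_on O f -> O x -> (hessian f x)^T = hessian f x.
Proof.
move=> oO C2 Ox; apply/matrixP => i j; rewrite !mxE.
apply/eqP; rewrite -subr_eq0 -normr_le0; apply/ler_addgt0Pr => e e0; rewrite add0r.
have e20 : 0 < e / 2 by rewrite divr_gt0.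
have : \forall y \near x, O y /\
   (`|partial j (partial i f) x - partial j (partial i f) y| <= e / 2 /\
    `|partial i (partial j f) x - partial i (partial j f) y| <= e / 2).
  apply: filterI; first exact: open_nbhs_nbhs.
  have [_ _ c2] := C2 _ Ox; apply: filterI.
    by have [_ /cvgrPdist_le/(_ _ e20)] := c2 j i.
  by have [_ /cvgrPdist_le/(_ _ e20)] := c2 i j.
move=> /nbhs_ballP[d /= d0 Hd].
have {}Hd y : `|y - x| < d -> O y /\
   (`|partial j (partial i f) x - partial j (partial i f) y| <= e / 2 /\
    `|partial i (partial j f) x - partial i (partial j f) y| <= e / 2).
  by move=> yx; apply: Hd; rewrite -ball_normE /= distrC.
have [h h0 hd] : exists2 h : R, 0 < h & `|h| + `|h| < d.
  by exists (d / 4); [rewrite divr_gt0|rewrite gtr0_norm ?divr_gt0//; lra].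
have [|y yx Ey] := @second_difference f x i j h d hd.
  move=> y /Hd[/C2[_ c1 c2] _]; split; first by have [] := c1 i.
  by have [] := c2 j i.
have [|z zx Ez] := @second_difference f x j i h d hd.
  move=> z /Hd[/C2[_ c1 c2] _]; split; first by have [] := c1 j.
  by have [] := c2 i j.
have dist (a b c c' : R) : `|a - c| <= e / 2 -> `|b - c'| <= e / 2 -> c = c' ->
    `|a - b| <= e.
  move=> ac bc E; rewrite -E in bc; rewrite (splitr e) (le_trans (ler_distD c _ _))//.
  by rewrite lerD// distrC.
have swap (a b c c' r r' : R) : a - b - (c - c') = h * (h * r) ->
    a - c - (b - c') = h * (h * r') -> r = r'.
  rewrite (_ : a - b - _ = a - c - (b - c')); last by ring.
  by move=> -> /(mulfI (lt0r_neq0 h0))/(mulfI (lt0r_neq0 h0)).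
have [_ [Ey' _]] := Hd y yx; have [_ [_ Ez']] := Hd z zx.
apply: (dist _ _ _ _ Ey' Ez'); apply: (swap _ _ _ _ _ _ Ey).
by rewrite (_ : x + _ + _ = x + h *: 'e_j + h *: 'e_i); last exact: addrAC.
Qed.

End second_order.

(** * A stock of smooth functions, and the Euclidean inner product *)

Section smooth.
Context {R : realType} {N : nat}.
Implicit Types (f g : 'rV[R]_N -> R) (x v : 'rV[R]_N) (O : set 'rV[R]_N).

Lemma is_derive_comp_real f (g : R -> R) x v (d e : R) :
  is_derive x v f d -> is_derive (f x) (1 : R) g e ->
  is_derive x v (fun y => g (f y)) (e * d).
Proof.
move=> df dg.
have /is_derive_lineP df0 : is_derive (x + (0 : R) *: v) v f d.
  by rewrite scale0r addr0.
have -> : x = x + (0 : R) *: v by rewrite scale0r addr0.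
apply/is_derive_lineP.
by apply: (is_derive1_comp _ df0); rewrite /= scale0r addr0.
Qed.

(* An algebra of functions that is stable under [partial i], so that its
   members are C^2 by construction. *)
Inductive smooth : ('rV[R]_N -> R) -> Prop :=
| smooth_cst c : smooth (fun=> c)
| smooth_coord i : smooth (fun x => x 0 i)
| smoothD f g : smooth f -> smooth g -> smooth (fun x => f x + g x)
| smoothM f g : smooth f -> smooth g -> smooth (fun x => f x * g x)
| smooth_cos f : smooth f -> smooth (fun x => cos (f x))
| smooth_sin f : smooth f -> smooth (fun x => sin (f x)).

Lemma smooth_sum (I : Type) (r : seq I) (F : I -> 'rV[R]_N -> R) :
  (forall i, smooth (F i)) -> smooth (fun x => \sum_(i <- r) F i x).
Proof.
move=> sF; elim: r => [|i r IH].
  rewrite (_ : (fun x => _) = fun=> 0); first exact: smooth_cst.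
  by apply/funext => x; rewrite big_nil.
rewrite (_ : (fun x => _) = fun x => F i x + \sum_(j <- r) F j x).
  exact: smoothD.
by apply/funext => x; rewrite big_cons.
Qed.

Lemma smooth_partial f : smooth f ->
  (forall x i, derivable f x 'e_i) /\ (forall i, smooth (partial i f)).
Proof.
(* Producing the derivative as an explicit member g of the class lets one induction settle both
   derivability and stability. *)
suff H : smooth f -> forall i, exists2 g, smooth g & forall x, is_derive x 'e_i f (g x).
  move=> sf; split=> [x i|i]; have [g sg dg] := H sf i; first by have [] := dg x.
  rewrite (_ : partial i f = g) //; apply/funext => x.
  by have [_] := dg x.
elim=> {f} [c i|j i|f g _ IHf _ IHg i|f g sf IHf sg IHg i|f sf IHf i|f sf IHf i].
- by exists (fun=> 0); [exact: smooth_cst|move=> x; exact: is_derive_cst].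
- exists (fun=> (j == i)%:R); first exact: smooth_cst.
  move=> x; have -> : x = x + (0 : R) *: 'e_i by rewrite scale0r addr0.
  apply/is_derive_lineP.
  rewrite (_ : (fun s : R => _) = fun s : R => x 0 j + s * (j == i)%:R); last first.
    by apply/funext => s; rewrite !mxE.
  rewrite -[X in is_derive _ _ _ X]add0r.
  apply: (@is_deriveD _ _ _ (cst (x 0 j)) (fun s : R => s * _)).
  apply: (is_derive_eq (is_deriveM _ _)).
  by rewrite scaler0 add0r [_ *: _]mulr1.
- have [f' sf df] := IHf i; have [g' sg dg] := IHg i.
  by exists (fun x => f' x + g' x); [exact: smoothD|move=> x; exact: is_deriveD].
- have [f' sf' df] := IHf i; have [g' sg' dg] := IHg i.
  exists (fun x => f x * g' x + g x * f' x); last by move=> x; exact: is_deriveM.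
  by apply: smoothD; exact: smoothM.
- have [f' sf' df] := IHf i.
  exists (fun x => (-1 * sin (f x)) * f' x).
    by apply: smoothM => //; apply: smoothM; [exact: smooth_cst|exact: smooth_sin].
  by move=> x; rewrite mulN1r; exact: is_derive_comp_real.
- have [f' sf' df] := IHf i.
  exists (fun x => cos (f x) * f' x).
    by apply: smoothM => //; exact: smooth_cos.
  by move=> x; exact: is_derive_comp_real.
Qed.

Lemma smooth_continuous f : smooth f -> continuous f.
Proof.
elim=> {f} [c|i|f g _ cf _ cg|f g _ cf _ cg|f _ cf|f _ cf] x.
- exact: cst_continuous.
- exact: coord_continuous.
- exact: (@continuousD _ _ _ f g x (cf x) (cg x)).
- exact: (@continuousM _ _ f g x (cf x) (cg x)).
- by apply: (@continuous_comp _ _ _ f); [exact: cf|exact: continuous_cos].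
- by apply: (@continuous_comp _ _ _ f); [exact: cf|exact: continuous_sin].
Qed.

Lemma smooth_C2 O f : smooth f -> C2_on O f.
Proof.
move=> sf x _; have [df sdf] := smooth_partial sf.
split=> [|i|i j]; first exact: smooth_continuous.
  by split=> //; exact: smooth_continuous.
have [ddf sddf] := smooth_partial (sdf j).
by split=> //; exact: smooth_continuous.
Qed.

(** The norm of row vectors is the max norm, so Euclidean lengths are expressed through this
    product. *)
Definition dotp x v : R := \sum_i x 0 i * v 0 i.

Lemma smooth_dotp (F G : 'rV[R]_N -> 'rV[R]_N) :
  (forall i, smooth (fun x => F x 0 i)) -> (forall i, smooth (fun x => G x 0 i)) ->
  smooth (fun x => dotp (F x) (G x)).
Proof. by move=> sF sG; apply: smooth_sum => i; exact: smoothM. Qed.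

Lemma dotpC x v : dotp x v = dotp v x.
Proof. by apply: eq_bigr => i _; rewrite mulrC. Qed.

Lemma dotpDl x y v : dotp (x + y) v = dotp x v + dotp y v.
Proof. by rewrite -big_split; apply: eq_bigr => i _; rewrite mxE mulrDl. Qed.

Lemma dotpZl c x v : dotp (c *: x) v = c * dotp x v.
Proof. by rewrite mulr_sumr; apply: eq_bigr => i _; rewrite mxE mulrA. Qed.

Lemma dotpDr x y v : dotp v (x + y) = dotp v x + dotp v y.
Proof. by rewrite dotpC dotpDl !(dotpC v). Qed.

Lemma dotpZr c x v : dotp v (c *: x) = c * dotp v x.
Proof. by rewrite dotpC dotpZl (dotpC v). Qed.

Lemma dotp_ge0 x : 0 <= dotp x x.
Proof. by apply: sumr_ge0 => i _; rewrite -expr2 sqr_ge0. Qed.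

Lemma sqr_coord_le_dotp x i : (x 0 i) ^+ 2 <= dotp x x.
Proof.
rewrite /dotp (bigD1 i)//= -expr2 lerDl.
by apply: sumr_ge0 => j _; rewrite -expr2 sqr_ge0.
Qed.

Lemma dotp_eq0 x : dotp x x = 0 -> x = 0.
Proof.
move=> x0; apply/rowP => i; rewrite mxE; apply/eqP.
by rewrite -sqrf_eq0 eq_le sqr_ge0 -x0 sqr_coord_le_dotp.
Qed.

Lemma dotp_gt0 x : x != 0 -> 0 < dotp x x.
Proof.
move=> x0; rewrite lt_neqAle dotp_ge0 andbT eq_sym.
by apply: contra x0 => /eqP/dotp_eq0 ->.
Qed.

(** The squared length of <v, v> x - <x, v> v equals <v, v> times the difference of the two
    sides. *)
Lemma Cauchy_Schwarz x v : (dotp x v) ^+ 2 <= dotp x x * dotp v v.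
Proof.
have [->|v0] := eqVneq v 0.
  by rewrite -(scale0r 0) !dotpZr !mul0r expr0n /= mulr0.
have v_gt0 := dotp_gt0 v0.
have := dotp_ge0 (dotp v v *: x - dotp x v *: v).
rewrite -scaleNr !(dotpDl, dotpDr, dotpZl, dotpZr) (dotpC v x).
rewrite (_ : _ + _ = dotp v v * (dotp x x * dotp v v - dotp x v ^+ 2)); last by ring.
by rewrite pmulr_rge0// subr_ge0.
Qed.

Lemma dotp_bounded (A : set 'rV[R]_N) M : (forall x, A x -> dotp x x <= M) -> bounded_set A.
Proof.
move=> AM; exists (Num.max 1 M); split; first exact: num_real.
move=> M' MM' x Ax /=; rewrite [leLHS]/Num.norm /= mx_normrE; apply/bigmax_leP.
have M'1 : 1 < M' by apply: le_lt_trans MM'; rewrite le_max lexx.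
split; first exact/ltW/(lt_trans ltr01).
move=> [i j] _ /=; rewrite [i]ord1.
have xM' : (x 0 j) ^+ 2 <= M' * M'.
  apply: (le_trans (sqr_coord_le_dotp _ _)); apply: (le_trans (AM _ Ax)).
  have : M < M' by apply: le_lt_trans MM'; rewrite le_max lexx orbT.
  by move=> /ltW/le_trans; apply; rewrite ler_peMl// ltW// (lt_trans ltr01).
rewrite -ler_sqr ?nnegrE//; last by rewrite ltW// (lt_trans ltr01).
by rewrite real_normK ?num_real// expr2.
Qed.

End smooth.

(** * The largest eigenvalue as the maximum of the Rayleigh quotient *)

Section Rayleigh.
Context {R : realType} {n : nat}.
Implicit Types (H : 'M[R]_n.+1) (v w : 'rV[R]_n.+1).

Lemma qformE H v : qform H v = dotp (v *m H) v.
Proof. by rewrite /qform mxE; apply: eq_bigr => i _; rewrite [v^T _ _]mxE. Qed.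

Lemma qform_sym H v w : H^T = H -> dotp (v *m H) w = dotp (w *m H) v.
Proof.
have mxdot u u' : dotp u u' = (u *m u'^T) 0 0.
  by rewrite mxE; apply: eq_bigr => i _; rewrite [u'^T _ _]mxE.
move=> sH; rewrite dotpC !mxdot trmx_mul sH mulmxA //.
Qed.

(** The quadratic form attains its maximum M on the compact unit sphere, and homogeneity extends the
    bound to all vectors. A maximizer is an eigenvector, since otherwise moving it in the direction
    of its residual would violate the bound. *)
Lemma max_qform H : H^T = H ->
  exists (M : R) v, [/\ dotp v v = 1, v *m H = M *: v &
    forall w, qform H w <= M * dotp w w].
Proof.
move=> sH.
have c1 : continuous (fun v : 'rV[R]_n.+1 => dotp v v).
  apply: smooth_continuous; apply: smooth_dotp => // i; exact: smooth_coord.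
have c2 : continuous (fun v : 'rV[R]_n.+1 => qform H v).
  apply: smooth_continuous.
  rewrite (_ : (fun v => _) = fun v => dotp (v *m H) v); last first.
    by apply/funext => v; rewrite qformE.
  apply: smooth_dotp => // i; last exact: smooth_coord.
  rewrite (_ : (fun v => _) = fun v => \sum_j v 0 j * H j i); last first.
    by apply/funext => v; rewrite mxE.
  apply: smooth_sum => j; apply: smoothM; [exact: smooth_coord|exact: smooth_cst].
pose S := [set v : 'rV[R]_n.+1 | dotp v v = 1].
have S0 : S !=set0.
  exists 'e_ord0; rewrite /S /= /dotp (bigD1 ord0)//= big1 ?addr0.
    by rewrite !mxE !eqxx mulr1.
  by move=> i /negPf i0; rewrite !mxE i0 andbF mulr0.
have cS : compact S.
  apply: bounded_closed_compact.
    by apply: (@dotp_bounded _ _ _ 1) => v ->.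
  by apply: (@closed_comp _ _ (fun v => dotp v v) [set 1]) => [v _|]; [exact: c1|exact: closed_eq].
have [v] := compact_EVT_max S0 cS (continuous_subspaceT c2).
rewrite inE => Sv vmax.
set M := qform H v in vmax.
have maxM w : qform H w <= M * dotp w w.
  have [->|w0] := eqVneq w 0.
    by rewrite qformE mul0mx -(scale0r 0) !dotpZl !mul0r mulr0.
  have w_gt0 := dotp_gt0 w0.
  pose c := (Num.sqrt (dotp w w))^-1.
  have c2w : c * (c * dotp w w) = 1.
    rewrite mulrA -expr2 exprVn sqr_sqrtr ?ltW// mulVf// gt_eqF//.
  have := vmax (c *: w); rewrite inE /S /= dotpZl dotpZr => /(_ c2w).
  rewrite qformE -scalemxAl dotpZl dotpZr -qformE => le.
  have c0 : 0 < c * c by rewrite -expr2 exprn_gt0// invr_gt0 sqrtr_gt0.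
  by rewrite -(ler_pM2l c0) -mulrA (le_trans le)// mulrCA -mulrA c2w mulr1.
exists M, v; split => //.
apply/eqP; rewrite -subr_eq0; apply/eqP; set z := _ - _.
apply: dotp_eq0; apply/eqP; rewrite -[_ == 0]negbK; apply/negP => z0.
have {}z0 : 0 < dotp z z by rewrite lt_neqAle eq_sym z0 dotp_ge0.
have zE : dotp z z = dotp (v *m H) z - M * dotp v z.
  by rewrite {1}/z -scaleNr dotpDl dotpZl mulNr.
clearbody z.
(* Perturbing the maximizer v in the direction z = vH - Mv. *)
have pert (t : R) : 2 * t * dotp z z + t ^+ 2 * (qform H z - M * dotp z z) <= 0.
  have := maxM (v + t *: z).
  rewrite qformE mulmxDl -scalemxAl !(dotpDl, dotpDr, dotpZl, dotpZr).
  rewrite (qform_sym z v sH) -!qformE -/M Sv (dotpC z v) -subr_le0.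
  by apply: le_trans; rewrite zE le_eqVlt; apply/orP; left; apply/eqP; ring.
(* K strictly dominates the coefficient of t^2, so at t = <z, z> / K the linear term of [pert]
   prevails and the left side is positive. *)
pose K := `|qform H z - M * dotp z z| + 1.
have K0 : 0 < K by rewrite ltr_wpDl.
have := pert (dotp z z / K); rewrite leNgt => /negP; apply.
have t0 : 0 < dotp z z / K by rewrite divr_gt0.
set t := _ / K in t0 *.
have -> : 2 * t * dotp z z + t ^+ 2 * (qform H z - M * dotp z z) =
   t * (2 * dotp z z + t * (qform H z - M * dotp z z)) by ring.
rewrite mulr_gt0//.
have : - dotp z z < t * (qform H z - M * dotp z z).
  have tK : t * K = dotp z z by rewrite /t divfK// gt_eqF.
  have : - K < qform H z - M * dotp z z.
    by rewrite ltrNl (le_lt_trans (ler_norm _))// normrN ltrDl.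
  by rewrite -(ltr_pM2l t0) mulrN tK.
by move: (t * _) => a; lra.
Qed.

(** M is an eigenvalue and bounds all the others, so the set whose supremum is [P1plus] is bounded
    above and contains M. *)
Lemma qform_le_P1plus H w : H^T = H -> qform H w <= P1plus H * dotp w w.
Proof.
move=> /max_qform[M [v [v1 vH maxM]]].
apply: (le_trans (maxM w)); rewrite ler_wpM2r ?dotp_ge0//.
apply: ub_le_sup; last first.
  apply/eigenvalueP; exists v => //; apply/eqP => v0; move: v1.
  by rewrite v0 -(scale0r 0) dotpZl mul0r => /esym/eqP; rewrite oner_eq0.
exists M => a /eigenvalueP[u uH u0].
have := maxM u; rewrite qformE uH dotpZl ler_pM2r//; exact: dotp_gt0.
Qed.

(** An eigenvalue has to be exhibited first, because the supremum of the empty set is 0 by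
    default. *)
Lemma P1plus_le H (b : R) : H^T = H ->
  (forall v, dotp v v = 1 -> qform H v <= b) -> P1plus H <= b.
Proof.
move=> /max_qform[M [v [v1 vH maxM]]] Hb.
have Mb : M <= b by have := Hb v v1; rewrite qformE vH dotpZl v1 mulr1.
apply: ge_sup.
  exists M; apply/eigenvalueP; exists v => //; apply/eqP => v0; move: v1.
  by rewrite v0 -(scale0r 0) dotpZl mul0r => /esym/eqP; rewrite oner_eq0.
move=> a /eigenvalueP[u uH u0]; apply: le_trans Mb.
have := maxM u; rewrite qformE uH dotpZl ler_pM2r//; exact: dotp_gt0.
Qed.

End Rayleigh.

(** * Lower bound: a radial cosine as supersolution *)

Section lower_bound.
Context {R : realType}.

(** By the mean value theorem sin x = x cos c with 0 <= c <= x, and cos decreases on [0, pi]. This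
    inequality compares the tangential second derivative of the radial profile with the radial
    one. *)
Lemma mulr_cos_le_sin (x : R) : 0 <= x <= pi -> x * cos x <= sin x.
Proof.
move=> /andP[x0 xpi].
have [|c] := @MVT_segment R sin cos 0 x x0.
- by apply: continuous_subspaceT => y; exact: continuous_sin.
rewrite in_itv /= sin0 !subr0 => /andP[c0 cx] ->.
rewrite mulrC ler_wpM2r//.
have [->//|cx'] := eqVneq c x.
apply: ltW; rewrite ltr_cos ?in_itv /= ?x0 ?c0 ?xpi ?(le_trans cx)//.
by rewrite lt_neqAle cx' cx.
Qed.

(* The second derivative at 0 of the radial profile along the line
   t |-> y + t v, where a = |y|^2 and b = <y, v>. *)
Lemma cos_sqrt_line (k a b : R) : 0 <= k -> 0 <= a -> b ^+ 2 <= a ->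
  k * Num.sqrt a <= pi ->
  exists (G : R -> R) (q : R), [/\
    \forall t \near (0 : R), is_derive t (1 : R)
      (fun t : R => cos (k * Num.sqrt (a + 2 * b * t + t ^+ 2))) (G t),
    is_derive (0 : R) (1 : R) G q & q <= - k ^+ 2 * cos (k * Num.sqrt a)].
Proof.
move=> k0 a0 ba kpi.
have dlin (c t : R) : is_derive t (1 : R) (fun s : R => c * s) c.
  apply: (is_derive_eq (is_deriveM _ _)).
  by rewrite scaler0 addr0 [_ *: _]mulr1.
(* At the centre of the ball the square root is not differentiable, but cos is even and the profile
   is simply cos (k t). *)
have [a_eq0|a_neq0] := eqVneq a 0.
  have b_eq0 : b = 0.
    by apply/eqP; rewrite -sqrf_eq0 eq_le sqr_ge0 andbT -a_eq0.
  exists (fun t => - k * sin (k * t)), (- k * (cos (k * 0) * k)); split.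
  - near=> t.
    rewrite (_ : (fun _ => _) = fun t : R => cos (k * t)); last first.
      apply/funext => s.
      rewrite a_eq0 b_eq0 mulr0 mul0r !add0r sqrtr_sqr -cos_norm normrM.
      by rewrite (ger0_norm k0) (ger0_norm (normr_ge0 s)) -[in LHS](ger0_norm k0) -normrM cos_norm.
    have := @is_derive1_comp R cos (fun t => k * t) t _ _ (is_derive_cos _) (dlin k t).
    by move=> H; apply: (is_derive_eq H); ring.
  - exact: (@is_deriveZ _ _ _ (fun t : R => sin (k * t)) (- k) 0 1 (cos (k * 0) * k)).
  - by rewrite a_eq0 sqrtr0 mulr0 cos0 mul1r mulr1 mulNr expr2.
have {}a0 : 0 < a by rewrite lt_neqAle eq_sym a_neq0.
pose p (t : R) : R := a + 2 * b * t + t ^+ 2.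
pose r (t : R) : R := Num.sqrt (p t).
have dp (t : R) : is_derive t (1 : R) p (2 * b + t *+ 2).
  have d1 : is_derive t (1 : R) (fun t : R => a + 2 * b * t) (2 * b).
    rewrite -[X in is_derive _ _ _ X]add0r.
    exact: (@is_deriveD _ _ _ (cst a) (fun t : R => 2 * b * t)).
  have d2 : is_derive t (1 : R) (fun t : R => t ^+ 2) (t *+ 2).
    have H := @is_deriveM _ _ id id t 1 _ _ (is_derive_id t 1) (is_derive_id t 1).
    by apply: (is_derive_eq H); rewrite [_ *: _]mulr1 mulr2n.
  exact: is_deriveD.
have dr (t : R) : 0 < p t -> is_derive t (1 : R) r ((b + t) / r t).
  move=> pt.
  have := @is_derive1_comp R Num.sqrt p t _ _ (is_derive1_sqrt pt) (dp t).
  rewrite -/(r t) (_ : _ * _ = (b + t) / r t)//.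
  by rewrite /r -mulr_natl; field; rewrite gt_eqF// sqrtr_gt0.
have ds (t : R) : 0 < p t ->
    is_derive t (1 : R) (fun t => k * r t) (k * ((b + t) / r t)).
  by move=> /dr; exact: is_deriveZ.
have p0 : p 0 = a by rewrite /p mulr0 expr0n /= !addr0.
have np : \forall t \near (0 : R), 0 < p t.
  have [/derivable1_diffP/differentiable_continuous cp _] := dp 0.
  by apply: (@cvgr_gt _ _ _ _ p (p 0) cp); rewrite p0.
pose G (t : R) : R := - k * (sin (k * r t) * ((b + t) * (r t)^-1)).
pose s := r 0.
have s0 : 0 < s by rewrite /s /r p0 sqrtr_gt0.
have sa : s ^+ 2 = a by rewrite /s /r p0 sqr_sqrtr// ltW.
pose q := - k * (sin (k * s) * (s^-1 - b * (b / s) / s ^+ 2) +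
   (b / s) * (cos (k * s) * (k * (b / s)))).
exists G, q; split.
- apply: filterS np => t pt.
  have := @is_derive1_comp R cos (fun t => k * r t) t _ _ (is_derive_cos _) (ds _ pt).
  by rewrite /G (_ : _ * _ = - k * (sin (k * r t) * ((b + t) / r t)))//; ring.
- apply: is_deriveZ.
  have pp0 : 0 < p 0 by rewrite p0.
  have d1 := @is_derive1_comp R sin (fun t => k * r t) 0 _ _ (is_derive_sin _) (ds _ pp0).
  have d2 : is_derive (0 : R) (1 : R) (fun t => (b + t) * (r t)^-1)
      (s^-1 - b * (b / s) / s ^+ 2).
    have dV := is_deriveV (lt0r_neq0 s0) (dr _ pp0).
    have dB : is_derive (0 : R) (1 : R) (fun t : R => b + t) 1.
      rewrite -[X in is_derive _ _ _ X]add0r.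
      exact: (@is_deriveD _ _ _ (cst b) id).
    apply: (is_derive_eq (is_deriveM dB dV)); rewrite addr0 -/s /GRing.scale /=; field; exact/lt0r_neq0.
  apply: (is_derive_eq (is_deriveM d1 d2)).
  by rewrite /GRing.scale /= addr0 -/s.
- rewrite -p0 -/(r 0) -/s.
  have key : k * s * cos (k * s) <= sin (k * s).
    by apply: mulr_cos_le_sin; rewrite mulr_ge0 ?(ltW s0)//= /s /r p0.
  have ba1 : b ^+ 2 / s ^+ 2 <= 1 by rewrite sa ler_pdivrMr// mul1r.
  rewrite -subr_ge0.
  (* The gap is a product of nonnegative factors: the hypothesis b^2 <= a handles 1 - b^2 / s^2, and
     [mulr_cos_le_sin] the last one. *)
  rewrite (_ : _ - q = k / s * ((1 - b ^+ 2 / s ^+ 2) * (sin (k * s) - k * s * cos (k * s)))).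
    by rewrite mulr_ge0// ?divr_ge0 ?(ltW s0)// mulr_ge0// subr_ge0.
  by rewrite /q; field; exact/lt0r_neq0.
Unshelve. all: by end_near. Qed.

Lemma lsc_continuous {N : nat} (O : set 'rV[R]_N) phi : continuous phi -> lsc_on O phi.
Proof.
move=> cphi x a; rewrite lte_fin => ax.
have /(_ x) c : continuous (phi : subspace O -> R) by exact: continuous_subspaceT.
exists [set y | a < phi y] => //.
exact: (cvgr_gt (phi x) c).
Qed.

(** The supersolution is cos (k |x - c|), positive because k r = pi / 2. If psi touches it from
    below at x0, then along every unit direction the difference has a minimum, so the quadratic form
    of the Hessian of psi is at most the second derivative of the profile. Only restrictions to
    lines are differentiated, which avoids computing the Hessian of the radial function. *)
Lemma mu1plus_ge (n : nat) (O : set 'rV[R]_n.+1) (c : 'rV[R]_n.+1) (r : R) :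
  0 < r -> open O -> (forall x, O x -> dotp (x - c) (x - c) < r ^+ 2) ->
  (((pi / (2 * r)) ^+ 2)%:E <= mu1plus O)%E.
Proof.
move=> r0 oO Or; set k := pi / (2 * r).
have k0 : 0 < k by rewrite divr_gt0 ?pi_gt0// mulr_gt0.
pose phi (x : 'rV[R]_n.+1) : R := cos (k * Num.sqrt (dotp (x - c) (x - c))).
have sr x : O x -> Num.sqrt (dotp (x - c) (x - c)) < r.
  by move=> /Or xr; rewrite -(ger0_norm (ltW r0)) -sqrtr_sqr ltr_sqrt// exprn_gt0.
have kr : k * r = pi / 2 by rewrite /k; field; exact/lt0r_neq0.
apply: ereal_sup_ubound; exists (k ^+ 2) => //; exists phi; split.
- apply: lsc_continuous => x.
  have cd : continuous (fun x : 'rV[R]_n.+1 => dotp (x - c) (x - c)).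
    have sc i : smooth (fun x : 'rV[R]_n.+1 => (x - c) 0 i).
      rewrite (_ : (fun _ => _) = fun x : 'rV[R]_n.+1 => x 0 i + (- c) 0 i).
        by apply: smoothD; [exact: smooth_coord|exact: smooth_cst].
      by apply/funext => y; rewrite mxE.
    exact: smooth_continuous (smooth_dotp sc sc).
  have c1 : {for x, continuous (fun x : 'rV[R]_n.+1 => Num.sqrt (dotp (x - c) (x - c)))}.
    by apply: continuous_comp; [exact: (cd x)|exact: sqrt_continuous].
  have c2 : {for x, continuous (fun x : 'rV[R]_n.+1 => k * Num.sqrt (dotp (x - c) (x - c)))}.
    apply: (@continuousM _ _ (fun=> k)
      (fun x : 'rV[R]_n.+1 => Num.sqrt (dotp (x - c) (x - c))) x _ c1).
    exact: cst_continuous.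
  by apply: continuous_comp; [exact: c2|exact: continuous_cos].
- move=> x /sr xr; apply: cos_gt0_pihalf.
  rewrite -kr ltr_pM2l// xr andbT; apply: lt_le_trans (mulr_ge0 (ltW k0) (sqrtr_ge0 _)).
  by rewrite oppr_lt0 mulr_gt0.
- move=> psi C2 x0 Ox0 xmin.
  have : P1plus (hessian psi x0) <= - k ^+ 2 * phi x0; last by lra.
  apply: P1plus_le; first exact: hessian_sym oO C2 Ox0.
  move=> v v1.
  have [d1 d2] := C2_line v oO C2 Ox0.
  pose y := x0 - c.
  have [||||G [q [dG dq qle]]] := @cos_sqrt_line k (dotp y y) (dotp y v).
  - exact: ltW.
  - exact: dotp_ge0.
  - by have := Cauchy_Schwarz y v; rewrite v1 mulr1.
  - apply: (@le_trans _ _ (k * r)); first by rewrite ler_pM2l// ltW// sr.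
    by rewrite kr; have := pi_gt0 R; lra.
  apply: le_trans qle; rewrite -subr_ge0.
  set g := fun t : R => _ in dG.
  have gE t : g t = phi (x0 + t *: v).
    rewrite /g /phi (addrAC x0) -/y; clearbody y; rewrite !(dotpDl, dotpDr, dotpZl, dotpZr) v1 (dotpC v y).
    by congr (cos (k * Num.sqrt _)); ring.
  pose u (t : R) := psi (x0 + t *: v).
  apply: (@second_derivative_test R (fun t => g t - u t)
    (fun t => G t - \sum_i v 0 i * partial i psi (x0 + t *: v))).
  - by apply: filterS2 dG d1 => t; exact: is_deriveB.
  - rewrite !gE /u scale0r addr0.
    have : (fun t : R => x0 + t *: v) @ (0 : R) --> x0.
      rewrite -[X in _ --> X]addr0 -(scale0r v).
      apply: cvgD; first exact: cvg_cst.
      by apply: cvgZr_tmp; exact: cvg_id.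
    move=> /(_ _ xmin) xm.
    by apply: (@filterS _ (nbhs (0 : R)) _ _ _ _ xm) => t; rewrite gE.
Qed.

End lower_bound.

(** * Upper bound: sliding a bump under a supersolution in a tube *)

Section upper_bound.
Context {R : realType}.

(** As O is open, the neighbourhoods of its points in [subspace O] yield neighbourhoods in the whole
    space. *)
Lemma lsc_on_near {N : nat} (O : set 'rV[R]_N) phi x (e : R) :
  open O -> lsc_on O phi -> O x -> 0 < e -> \forall y \near x, phi x - e < phi y.
Proof.
move=> oO lphi Ox e0.
have [|V + HV] := lphi x (phi x - e); first by rewrite lte_fin ltrBlDr ltrDl.
rewrite /nbhs /= -(nbhs_subspace_in Ox) => xV.
have xO : \forall y \near x, O y by exact: open_nbhs_nbhs.
by apply: filterS2 xO xV => y Oy /(_ Oy)/HV; rewrite lte_fin.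
Qed.

(** Near each x of K the function exceeds f x / 2, so every d < f x / 2 works locally; compactness
    makes one small d work on all of K. *)
Lemma lsc_compact_pos (T : topologicalType) (f : T -> R) (K : set T) : compact K ->
  (forall x, K x -> forall e, 0 < e -> \forall y \near x, f x - e < f y) ->
  (forall x, K x -> 0 < f x) -> exists2 d, 0 < d & forall x, K x -> d <= f x.
Proof.
move=> /compact_near_coveringP cK lf fpos.
have H : \forall d \near (0 : R)^'+, K `<=` (fun x => d <= f x).
  apply: cK => x Kx; have fx := fpos x Kx.
  have fx2 : 0 < f x / 2 by rewrite divr_gt0.
  exists ([set y | f x - f x / 2 < f y], [set d | d < f x / 2]).
    by split; [exact: lf|exact: nbhs_right_lt].
  by move=> [y d] [/= y1 d1]; lra.
near (0 : R)^'+ => d; exists d; first by near: d; exact: nbhs_right_gt.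
by move=> x Kx; move: x Kx; near: d.
Unshelve. all: by end_near. Qed.

Context {n : nat}.
Implicit Types (O K : set 'rV[R]_n.+1) (phi : 'rV[R]_n.+1 -> R) (a x : 'rV[R]_n.+1).

(** The coordinate along a, scaled so that a itself has coordinate 1. *)
Definition axial a x : R := dotp x a / dotp a a.

Definition transverse a x : 'rV[R]_n.+1 := x - axial a x *: a.

(** A solid cylinder around the segment from - s a to s a, for D > 0 of radius 1 / sqrt D: a large D
    makes it thin. *)
Definition tube a (s D : R) : set 'rV[R]_n.+1 :=
  [set x | `|axial a x| <= s /\ D * dotp (transverse a x) (transverse a x) <= 1].

(** With k s = pi / 2 the cosine vanishes on the two ends of the tube and the parabola on its
    lateral side. *)
Definition bump a (k D : R) x : R :=
  cos (k * axial a x) * (1 - D * dotp (transverse a x) (transverse a x)).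

Lemma axial_line a x (t : R) : a != 0 -> axial a (x + t *: a) = axial a x + t.
Proof.
by move=> /dotp_gt0 a0; rewrite /axial dotpDl dotpZl mulrDl mulfK// gt_eqF.
Qed.

Lemma transverse_line a x (t : R) : a != 0 -> transverse a (x + t *: a) = transverse a x.
Proof.
by move=> a0; rewrite /transverse axial_line// scalerDl opprD addrACA subrr addr0.
Qed.

Lemma smooth_axial a : smooth (axial a).
Proof.
apply: (smoothM (smooth_dotp _ _)); last exact: smooth_cst.
  by move=> i; exact: smooth_coord.
by move=> i; exact: (smooth_cst (a 0 i)).
Qed.

Lemma smooth_transverse a : smooth (fun x => dotp (transverse a x) (transverse a x)).
Proof.
have st i : smooth (fun x => transverse a x 0 i).
  rewrite (_ : (fun _ => _) = fun x => x 0 i + axial a x * - a 0 i).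
    apply: (smoothD (smooth_coord i)).
    by apply: (smoothM (smooth_axial a)); exact: smooth_cst.
  by apply/funext => x; rewrite !mxE mulrN.
exact: smooth_dotp.
Qed.

Lemma smooth_bump a k D : smooth (bump a k D).
Proof.
apply: smoothM; first by apply/smooth_cos/smoothM; [exact: smooth_cst|exact: smooth_axial].
apply: smoothD; first exact: smooth_cst.
rewrite (_ : (fun _ => _) = fun x => (- D) * dotp (transverse a x) (transverse a x)).
  by apply: smoothM; [exact: smooth_cst|exact: smooth_transverse].
by apply/funext => x; rewrite mulNr.
Qed.

Lemma closed_tube a s D : closed (tube a s D).
Proof.
rewrite (_ : tube a s D = [set x | `|axial a x| <= s] `&`
   [set x | D * dotp (transverse a x) (transverse a x) <= 1])//.
apply: closedI.
  apply: (@closed_comp _ _ (fun x => `|axial a x|) [set r | r <= s]) => [x _|]; last exact: closed_le.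
  apply: (@continuous_comp _ _ _ (axial a)); last exact: norm_continuous.
  exact/smooth_continuous/smooth_axial.
apply: (@closed_comp _ _ (fun x => D * dotp (transverse a x) (transverse a x))
  [set r | r <= 1]) => [x _|]; last exact: closed_le.
apply: (smooth_continuous (smoothM (smooth_cst D) (smooth_transverse a))).
Qed.

Lemma bounded_tube a s D : 0 < D -> bounded_set (tube a s D).
Proof.
move=> D0; apply: (@dotp_bounded _ _ _ (2 * (s ^+ 2 * dotp a a) + 2 * D^-1)) => x [xs xD].
have -> : x = axial a x *: a + transverse a x by rewrite addrC subrK.
set z := transverse a x in xD *; set l := axial a x in xs *.
have zD : dotp z z <= D^-1 by rewrite -[D^-1]mul1r ler_pdivlMr// mulrC.
have ls : l ^+ 2 * dotp a a <= s ^+ 2 * dotp a a.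
  rewrite ler_wpM2r ?dotp_ge0// -real_normK ?num_real// ler_sqr ?nnegrE//.
  exact: le_trans xs.
(* This square gives |l a + z|^2 <= 2 |l a|^2 + 2 |z|^2. *)
have := dotp_ge0 (l *: a + (-1) *: z); clearbody z l.
rewrite !(dotpDl, dotpDr, dotpZl, dotpZr) (dotpC z a).
move: (dotp z z) (dotp a z) (dotp a a) zD ls => zz az aa zD ls; nra.
Qed.

Lemma compact_tube a s D : 0 < D -> compact (tube a s D).
Proof.
by move=> D0; apply: bounded_closed_compact; [exact: bounded_tube|exact: closed_tube].
Qed.

(* The bump lies below phi up to a critical multiple c, for which it touches phi
   at a point where it is positive, hence inside the tube; there the second
   derivative of the bump along the axis bounds its Hessian from below. *)
Lemma tube_supersolution O phi mu a s D : open O -> a != 0 -> 0 < s -> 0 < D ->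
  tube a s D `<=` O -> lsc_on O phi -> (forall x, O x -> 0 < phi x) ->
  viscosity_supersolution mu O phi -> mu * dotp a a <= (pi / (2 * s)) ^+ 2.
Proof.
move=> oO a0 s0 D0 KO lphi phi0 vphi; set k := pi / (2 * s).
have k0 : 0 < k by rewrite divr_gt0 ?pi_gt0// mulr_gt0.
have ks : k * s = pi / 2 by rewrite /k; field; exact/lt0r_neq0.
pose K := tube a s D; pose w := bump a k D.
have cK : compact K by exact: compact_tube.
have kl x : K x -> - (pi / 2) <= k * axial a x <= pi / 2.
  by move=> [xs _]; rewrite -ler_norml normrM gtr0_norm// -ks ler_pM2l.
have w_ge0 x : K x -> 0 <= w x.
  move=> Kx; apply: mulr_ge0; first exact/cos_ge0_pihalf/kl.
  by rewrite subr_ge0; exact: Kx.2.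
have w_le1 x : K x -> w x <= 1.
  move=> Kx; rewrite -[leRHS]mulr1; apply: ler_pM.
  - exact/cos_ge0_pihalf/kl.
  - by rewrite subr_ge0; exact: Kx.2.
  - exact: cos_le1.
  - by rewrite lerBlDr lerDl mulr_ge0 ?dotp_ge0// ltW.
have axial0 : axial a 0 = 0 by rewrite /axial -(scale0r 0) dotpZl !mul0r.
have trans0 : transverse a 0 = 0 by rewrite /transverse axial0 scale0r subr0.
have dot00 : dotp 0 0 = 0 :> R.
  by move=> m; rewrite -(scale0r 0) dotpZl mul0r.
have K0 : K 0 by split; rewrite ?axial0 ?normr0 ?(ltW s0)// trans0 dot00 mulr0.
have w0 : w 0 = 1 by rewrite /w /bump axial0 trans0 dot00 !mulr0 cos0 subr0 mul1r.
have lnear x e : K x -> 0 < e -> \forall y \near x, phi x - e < phi y.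
  by move=> /KO; exact: lsc_on_near.
pose E := [set c : R | forall x, K x -> c * w x <= phi x].
have [d0 d0_gt0 d0K] : exists2 d, 0 < d & forall x, K x -> d <= phi x.
  by apply: (lsc_compact_pos cK) => x Kx; [move=> e; exact: lnear|exact/phi0/KO].
have Ed0 : E d0.
  move=> x Kx; apply: le_trans (d0K x Kx).
  by rewrite ler_piMr ?(ltW d0_gt0)// w_le1.
have supE : has_sup E.
  split; first by exists d0.
  by exists (phi 0) => c /(_ 0 K0); rewrite w0 mulr1.
pose c := sup E.
have c0 : 0 < c by apply: lt_le_trans d0_gt0 _; exact: ub_le_sup supE.2 _ Ed0.
have cE x : K x -> c * w x <= phi x.
  move=> Kx; have [w_eq0|w_neq0] := eqVneq (w x) 0.
    by rewrite w_eq0 mulr0 ltW//; exact/phi0/KO.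
  have w_gt0 : 0 < w x by rewrite lt_neqAle eq_sym w_neq0 w_ge0.
  rewrite -ler_pdivlMr//; apply: ge_sup; first by exists d0.
  by move=> c' /(_ x Kx); rewrite ler_pdivlMr.
(* Without contact, phi - c w would be at least some d > 0 on the compact tube; as w <= 1 there, c +
   d would still lie in E, against the choice of c. *)
have [x0 [Kx0 touch]] : exists x0, K x0 /\ phi x0 = c * w x0.
  apply: contrapT => nex.
  have pos x : K x -> 0 < phi x - c * w x.
    move=> Kx; rewrite subr_gt0 lt_neqAle cE// andbT; apply/eqP => e.
    by apply: nex; exists x.
  have [d d_gt0 dK] : exists2 d, 0 < d & forall x, K x -> d <= phi x - c * w x.
    apply: (lsc_compact_pos cK) => // x Kx e e0.
    have e2 : 0 < e / 2 by rewrite divr_gt0.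
    have cwx : (fun y => c * w y) @ x --> c * w x.
      exact: (smooth_continuous (smoothM (smooth_cst c) (smooth_bump a k D))) x.
    have /cvgrPdist_lt/(_ _ e2) := cwx.
    apply: filterS2 (lnear x (e / 2) Kx e2) => y h1; rewrite ltr_norml => /andP[h2 h3].
    by move: (c * w y) (c * w x) h2 h3 => p q; lra.
  have : E (c + d).
    move=> x Kx; have := dK x Kx; rewrite mulrDl.
    have : d * w x <= d by rewrite ler_piMr ?w_le1// (ltW d_gt0).
    by move: (d * w x) (c * w x) => p q; lra.
  by move=> /(ub_le_sup supE.2); rewrite -/c gerDl leNgt d_gt0.
have phix0 : 0 < phi x0 by exact/phi0/KO.
have wx0 : 0 < w x0 by move: phix0; rewrite touch pmulr_rgt0.
(* The bump vanishes on the boundary of the tube, so the contact point is interior; hence c w <= phi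
   holds in a neighbourhood and c w is an admissible test function. *)
have in1 : `|axial a x0| < s.
  rewrite lt_neqAle Kx0.1 andbT; apply/eqP => eqs.
  move: wx0; rewrite /w /bump -cos_norm normrM (gtr0_norm k0) eqs ks cos_pihalf.
  by rewrite mul0r ltxx.
have in2 : D * dotp (transverse a x0) (transverse a x0) < 1.
  rewrite lt_neqAle Kx0.2 andbT; apply/eqP => eq1.
  by move: wx0; rewrite /w /bump eq1 subrr mulr0 ltxx.
have nearK : \forall x \near x0, K x.
  have c1 : (fun x => `|axial a x|) @ x0 --> `|axial a x0|.
    apply: (@continuous_comp _ _ _ (axial a)); last exact: norm_continuous.
    exact/smooth_continuous/smooth_axial.
  have c2 : (fun x => D * dotp (transverse a x) (transverse a x)) @ x0 -->
      D * dotp (transverse a x0) (transverse a x0).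
    exact: (smooth_continuous (smoothM (smooth_cst D) (smooth_transverse a))).
  have n1 : \forall x \near x0, `|axial a x| < s by exact: (cvgr_lt _ c1 _ in1).
  have n2 : \forall x \near x0, D * dotp (transverse a x) (transverse a x) < 1.
    by exact: (cvgr_lt _ c2 _ in2).
  by apply: (filterS2 (nbhs_filter x0) _ n1 n2) => x /ltW ? /ltW ?; split.
pose psi x := c * w x.
have spsi : smooth psi by apply: (smoothM (smooth_cst c)); exact: smooth_bump.
have C2psi : C2_on O psi by exact: smooth_C2.
have Ox0 := KO _ Kx0.
have psimin : \forall x \near x0, phi x0 - psi x0 <= phi x - psi x.
  by apply: filterS nearK => x Kx; rewrite touch subrr subr_ge0 cE.
have visc := vphi psi C2psi x0 Ox0 psimin.
have [d1 d2] := C2_line a oO C2psi Ox0.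
pose A := 1 - D * dotp (transverse a x0) (transverse a x0).
(* Along the axis the transverse factor A is constant, so psi is a pure cosine and its second
   derivative is - k^2 psi. *)
have lineE t : psi (x0 + t *: a) = c * A * cos (k * axial a x0 + k * t).
  by rewrite /psi /w /bump axial_line// transverse_line// -/A (mulrDr k); ring.
have dl t : is_derive t (1 : R) (fun t => k * axial a x0 + k * t) k.
  rewrite -[X in is_derive _ _ _ X]add0r.
  apply: (@is_deriveD _ _ _ (cst (k * axial a x0)) (fun t : R => k * t)).
  apply: (is_derive_eq (is_deriveM _ _)).
  by rewrite scaler0 addr0 [_ *: _]mulr1.
have dl1 t : is_derive t (1 : R) (fun t => psi (x0 + t *: a))
    (c * A * (- sin (k * axial a x0 + k * t) * k)).
  rewrite (_ : (fun _ => _) = fun t => c * A * cos (k * axial a x0 + k * t)); last first.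
    by apply/funext => r; exact: lineE.
  have H := is_derive1_comp (is_derive_cos _) (dl t).
  exact: (@is_deriveZ _ _ _ (fun t => cos (k * axial a x0 + k * t)) (c * A) t 1 _ H).
have dl2 : is_derive (0 : R) (1 : R)
    (fun t => c * A * (- sin (k * axial a x0 + k * t) * k)) (- k ^+ 2 * psi x0).
  rewrite (_ : (fun _ => _) = fun t => - (c * A * k) * sin (k * axial a x0 + k * t)); last first.
    by apply/funext => r; ring.
  have H := is_derive1_comp (is_derive_sin _) (dl 0).
  apply: (is_derive_eq (@is_deriveZ _ _ _ (fun t => sin (k * axial a x0 + k * t))
    (- (c * A * k)) 0 1 _ H)).
  have -> : psi x0 = c * A * cos (k * axial a x0 + k * 0).
    by rewrite -lineE scale0r addr0.
  by rewrite /GRing.scale /=; ring.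
have qE : qform (hessian psi x0) a = - k ^+ 2 * psi x0.
  have [_ <-] := d2; have [_ <-] := dl2.
  apply: near_eq_derive; apply: filterS d1 => t [_ <-].
  by have [_ <-] := dl1 t.
have := qform_le_P1plus a (hessian_sym oO C2psi Ox0).
rewrite qE /psi -touch => P1.
have aa := dotp_gt0 a0.
rewrite -(ler_pM2r phix0).
(* Together with - k^2 phi x0 <= P1plus |a|^2 from [P1], this yields mu |a|^2 phi x0 <= k^2 phi
   x0. *)
have : (P1plus (hessian psi x0) + mu * phi x0) * dotp a a <= 0.
  by rewrite mulr_le0_ge0// ltW.
move: P1; rewrite -/psi; move: (P1plus _) => p; nra.
Qed.

End upper_bound.

(** * Bounds for boxes in terms of their half-diagonal *)

Section boxes.
Context {R : realType} {n : nat}.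
Implicit Types (b : 'I_n.+1 -> R) (c x : 'rV[R]_n.+1).

Definition box c b : set 'rV[R]_n.+1 := [set x | forall i, - b i < x 0 i - c 0 i < b i].

Lemma Rect_box (rho : R) (alpha : 'I_n.+1 -> R) :
  Rect rho alpha = box 0 (fun i => (alpha i)^-1 * rho).
Proof.
by apply/seteqP; split => x Hx i; have := Hx i; rewrite mxE subr0.
Qed.

Lemma translate_box x b : translate x (box 0 b) = box x b.
Proof.
apply/seteqP; split => [_ [y Hy <-] i|y Hy].
  by have := Hy i; rewrite !mxE subr0 [_ + _ - _]addrAC subrr add0r.
exists (y - x); last by rewrite addrC subrK.
by move=> i; have := Hy i; rewrite !mxE subr0.
Qed.

Lemma open_box c b : open (box c b).
Proof.
rewrite openE => x Hx.
refine (@filter_forall _ 'I_n.+1 (fun i (y : 'rV[R]_n.+1) => is_true (- b i < y 0 i - c 0 i < b i))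
  _ (nbhs_filter x) _) => i.
have cx : (fun y : 'rV[R]_n.+1 => y 0 i - c 0 i) @ x --> x 0 i - c 0 i.
  exact: (smooth_continuous (smoothD (smooth_coord i) (smooth_cst (- c 0 i)))).
have /andP[h1 h2] := Hx i.
apply: (filterS2 (nbhs_filter x) _ (cvgr_gt _ cx _ h1) (cvgr_lt _ cx _ h2)) => y.
by move=> /= -> ->.
Qed.

Lemma box_sqr_lt c b x : box c b x -> dotp (x - c) (x - c) < \sum_i b i ^+ 2.
Proof.
move=> Hx; apply: ltr_sum; first by apply/hasP; exists ord0; rewrite ?mem_index_enum.
move=> i _; rewrite mxE -expr2; have /andP[h1 h2] := Hx i.
by rewrite mxE; set y := _ - _ in h1 h2 *; nra.
Qed.

Lemma bounded_domain_box b : (forall i, 0 < b i) -> bounded_domain (box 0 b).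
Proof.
move=> b0.
have B0 : box 0 b 0 by move=> i; rewrite !mxE subrr oppr_lt0 b0.
split; first by exists 0.
- exact: open_box.
(* The box is star-shaped about 0: it is a union of segments issuing from 0. *)
- rewrite (_ : box 0 b = \bigcup_(x in box 0 b) [set t *: x | t in `[0, 1]%classic]).
    apply: bigcup_connected.
      by exists 0 => x _; exists 0; rewrite ?scale0r//= in_itv /= lexx ler01.
    move=> x _; apply: connected_continuous_connected; first exact: segment_connected.
    apply: continuous_subspaceT => t.
    by apply: cvgZr_tmp; exact: cvg_id.
  apply/seteqP; split => [x Hx|_ [x Hx [t + <-]]].
    by exists x => //; exists 1; rewrite ?scale1r//= in_itv /= lexx ler01.
  rewrite /= in_itv /= => /andP[t0 t1] i; have := Hx i; rewrite !mxE !subr0.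
  by have := b0 i; move: (b i) (x 0 i) => y z y0 /andP[h1 h2]; apply/andP; split; nra.
- apply: (@dotp_bounded _ _ _ (\sum_i b i ^+ 2)) => x /box_sqr_lt/ltW.
  by rewrite subr0.
Qed.

(** For each s < 1 a thin enough tube around the diagonal from - s b to s b fits in the box; the
    bound follows by letting s approach 1. *)
Lemma mu1plus_box_le b : (forall i, 0 < b i) ->
  (mu1plus (box 0 b) <= ((pi / 2) ^+ 2 / \sum_i b i ^+ 2)%:E)%E.
Proof.
move=> b0; apply: ge_ereal_sup => _ [mu [phi [lphi phi0 vphi]] <-].
rewrite lee_fin.
pose a : 'rV[R]_n.+1 := \row_i b i.
have aE : dotp a a = \sum_i b i ^+ 2.
  by apply: eq_bigr => i _; rewrite !mxE expr2.
have a_neq0 : a != 0.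
  by apply/eqP => /rowP/(_ ord0); rewrite !mxE => b00; have := b0 ord0; rewrite b00 ltxx.
have aa := dotp_gt0 a_neq0.
have tubes s : 0 < s < 1 -> mu * dotp a a <= (pi / (2 * s)) ^+ 2.
  move=> /andP[s0 s1].
  (* The tube of radius e, that is D = 1 / e^2, stays in the box since s b_i + e < b_i for all i. *)
  have [e e0 eb] : exists2 e, 0 < e & forall i, e < (1 - s) * b i.
    have : \forall e \near (0 : R)^'+, forall i, e < (1 - s) * b i.
      refine (@filter_forall _ 'I_n.+1 (fun i e => is_true (e < (1 - s) * b i))
        _ _ _) => i.
      by apply: nbhs_right_lt; rewrite mulr_gt0// subr_gt0.
    move=> H; near (0 : R)^'+ => e; exists e; first by near: e; exact: nbhs_right_gt.
    by near: e.
  apply: (@tube_supersolution _ _ (box 0 b) phi mu a s (e ^- 2)) => //.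
  - exact: open_box.
  - by rewrite invr_gt0 exprn_gt0.
  - move=> x [xs xe] i; rewrite mxE subr0.
    have -> : x 0 i = axial a x * b i + transverse a x 0 i.
      by rewrite /transverse !mxE [RHS]addrC subrK.
    have ze : `|transverse a x 0 i| <= e.
      rewrite -ler_sqr ?nnegrE ?(ltW e0)// real_normK ?num_real//.
      apply: (le_trans (sqr_coord_le_dotp _ _)).
      by move: xe; rewrite mulrC ler_pdivrMr ?exprn_gt0// mul1r.
    have := eb i; have := b0 i; move: xs ze; rewrite !ler_norml.
    move: (axial a x) (transverse a x 0 i) (b i) => l z y /andP[l1 l2] /andP[z1 z2] y0 ey.
    by apply/andP; split; nra.
rewrite ler_pdivlMr -aE// leNgt; apply/negP => lt.
set P := (pi / 2) ^+ 2 in lt; set m := mu * dotp a a in lt tubes.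
have P0 : 0 < P by rewrite exprn_gt0// divr_gt0// pi_gt0.
have m0 : 0 < m by exact: lt_trans lt.
(* A definite s = 1 - ep replaces the limit: here P = (1 - 4 ep) m, while [tubes] gives (1 - ep)^2 m
   <= P, and (1 - ep)^2 > 1 - 4 ep. *)
pose ep := (m - P) / (4 * m).
have ep0 : 0 < ep by apply: divr_gt0; [rewrite subr_gt0|exact: mulr_gt0].
have m4 : 0 < 4 * m by rewrite mulr_gt0.
have ep1 : ep < 1 by rewrite /ep (ltr_pdivrMr _ _ m4) mul1r; lra.
have epm : 4 * (ep * m) = m - P by rewrite /ep; field; exact/lt0r_neq0.
have := tubes (1 - ep) _.
have s0 : 0 < 1 - ep by lra.
rewrite (_ : 0 < 1 - ep < 1); last by apply/andP; split; lra.
move=> /(_ isT).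
rewrite (_ : (pi / (2 * (1 - ep))) ^+ 2 = P / (1 - ep) ^+ 2); last first.
  by rewrite /P; field; exact/lt0r_neq0.
rewrite ler_pdivlMr ?exprn_gt0//.
move: epm ep0 s0 lt m0; clearbody m P ep; nra.
Unshelve. all: by end_near. Qed.

(** The ball circumscribed to the box contains O. Allowing any open subset, possibly empty, treats
    all intersections of A with translates of B alike. *)
Lemma mu1plus_sub_box_ge c b (O : set 'rV[R]_n.+1) : (forall i, 0 < b i) ->
  open O -> O `<=` box c b ->
  (((pi / 2) ^+ 2 / \sum_i b i ^+ 2)%:E <= mu1plus O)%E.
Proof.
move=> b0 oO Ob.
have S0 : 0 < \sum_i b i ^+ 2.
  rewrite (bigD1 ord0)//= ltr_pwDl ?exprn_gt0//.
  by apply: sumr_ge0 => i _; exact: sqr_ge0.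
have -> : (pi / 2) ^+ 2 / \sum_i b i ^+ 2 =
    (pi / (2 * Num.sqrt (\sum_i b i ^+ 2))) ^+ 2 :> R.
  by rewrite invfM mulrA (expr_div_n (pi / 2) (Num.sqrt _)) (sqr_sqrtr (ltW S0)).
apply: (@mu1plus_ge _ _ _ c); rewrite ?sqrtr_gt0//.
by move=> x /Ob/box_sqr_lt; rewrite (sqr_sqrtr (ltW S0)).
Qed.

End boxes.

(** * Comparison of the two rectangles with their intersections *)

Lemma sum_ord0_ord1 (R : realType) (n : nat) (F : 'I_n.+2 -> R) :
  \sum_i F i = F ord0 + F ord_1 + \sum_(i < n.+2 | (2 <= i)%N) F i.
Proof.
rewrite (bigD1 ord0)//= (bigD1 ord_1)//= addrA; congr (_ + _).
by apply: eq_bigl => -[[|[|i]] Hi].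
Qed.

(* The dimension N >= 2 is n.+2; alpha_1, alpha_2 are alpha ord0, alpha ord_1. *)
Theorem mainTheorem7 (R : realType) (n : nat) :
  (forall (rho : R) (alpha : 'I_n.+2 -> R),
     0 < rho ->
     (forall i, 0 < alpha i) ->
     (forall i j : 'I_n.+2, (i <= j)%N -> alpha i <= alpha j) ->
     3 / alpha ord_1 ^+ 2 + \sum_(i < n.+2 | (2 <= i)%N) 1 / alpha i ^+ 2
       < 1 / alpha ord0 ^+ 2 ->
     let A := Rect rho alpha in
     let B := Rect rho (fun i => alpha (tperm ord0 ord_1 i)) in
     (mu1plus A + mu1plus B <
        ereal_inf [set mu1plus (A `&` translate x B) | x in [set: 'rV[R]_n.+2]])%E)
  /\
  ~ (forall A B : set 'rV[R]_n.+2,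
       bounded_domain A -> bounded_domain B ->
       (ereal_inf [set mu1plus (A `&` translate x B) | x in [set: 'rV[R]_n.+2]]
          < mu1plus A + mu1plus B)%E).
Proof.
have part1 (rho : R) (alpha : 'I_n.+2 -> R) : 0 < rho -> (forall i, 0 < alpha i) ->
     (forall i j : 'I_n.+2, (i <= j)%N -> alpha i <= alpha j) ->
     3 / alpha ord_1 ^+ 2 + \sum_(i < n.+2 | (2 <= i)%N) 1 / alpha i ^+ 2
       < 1 / alpha ord0 ^+ 2 ->
     (mu1plus (Rect rho alpha) +
        mu1plus (Rect rho (fun i => alpha (tperm ord0 ord_1 i))) <
      ereal_inf [set mu1plus (Rect rho alpha `&`
        translate x (Rect rho (fun i => alpha (tperm ord0 ord_1 i))))
        | x in [set: 'rV[R]_n.+2]])%E.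
  move=> rho0 alpha0 _ hyp; rewrite !Rect_box.
  pose s : 'I_n.+2 -> 'I_n.+2 := tperm ord0 ord_1.
  pose b (i : 'I_n.+2) := (alpha i)^-1 * rho.
  have b0 i : 0 < b i by rewrite mulr_gt0// invr_gt0.
  (* In the first direction the translate of B is the narrower one, with half-length [b ord_1]; in
     the others the half-length of A is kept. *)
  pose d i := if i == ord0 then b ord_1 else b i.
  have d0 i : 0 < d i by rewrite /d; case: ifP.
  pose P := (pi / 2) ^+ 2 : R.
  pose S := \sum_i b i ^+ 2; pose T := \sum_i d i ^+ 2.
  have sumb : \sum_i b (s i) ^+ 2 = S.
    by rewrite /S [RHS](reindex_inj (@perm_inj _ (tperm ord0 ord_1))).
  have T0 : 0 < T.
    rewrite /T (bigD1 ord0)//= ltr_pwDl ?exprn_gt0//.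
    by apply: sumr_ge0 => i _; exact: sqr_ge0.
  (* With Q the sum of b_i^2 over the remaining directions, S = b_1^2 + b_2^2 + Q and T = 2 b_2^2 +
     Q, so the claim reads 3 b_2^2 + Q < b_1^2, the hypothesis multiplied by rho^2. *)
  have TS : 2 * T < S.
    rewrite /S /T !sum_ord0_ord1 /d /=.
    rewrite [X in 2 * (_ + X)](eq_bigr (fun i => b i ^+ 2)); last by move=> [[|i] Hi].
    have bE i : b i ^+ 2 = rho ^+ 2 * (1 / alpha i ^+ 2).
      by rewrite /b exprMn exprVn div1r mulrC.
    rewrite (eq_bigr _ (fun i _ => bE i)) -mulr_sumr !bE.
    have r2 : 0 < rho ^+ 2 by rewrite exprn_gt0.
    move: hyp; rewrite -(ltr_pM2l r2) -[3 / _]/(3 * _) -[_^-1]div1r.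
    move: (\sum_(i < _ | _) _) (1 / alpha ord_1 ^+ 2) (1 / alpha ord0 ^+ 2) (rho ^+ 2).
    by move=> p q r u; lra.
  have PTS : (P / S + P / S < P / T :> R).
    have P0 : 0 < P by rewrite exprn_gt0// divr_gt0// pi_gt0.
    have S0 : 0 < S by apply: lt_trans TS; rewrite mulr_gt0.
    rewrite -mulr2n -mulr_natl mulrCA ltr_pM2l//.
    by rewrite ltr_pdivrMr// mulrC ltr_pdivlMr.
  apply: (@le_lt_trans _ _ (P / S + P / S)%:E).
    rewrite EFinD; apply: leeD; first exact: mu1plus_box_le.
    by rewrite -sumb; apply: mu1plus_box_le => i; exact: (b0 (s i)).
  apply: (@lt_le_trans _ _ (P / T)%:E); first by rewrite lte_fin.
  apply: le_ereal_inf_tmp => _ [x _ <-]; rewrite translate_box.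
  (* The first coordinate is constrained by the translate of B, centred at x, and the others by A,
     centred at 0. *)
  pose c : 'rV[R]_n.+2 := \row_i (if i == ord0 then x 0 ord0 else 0).
  apply: (@mu1plus_sub_box_ge _ _ c d) => //; first by apply: openI; exact: open_box.
  move=> y [yA yB] i; rewrite /c /d mxE; case: eqP => [->|_].
    by have := yB ord0; rewrite tpermL.
  by have := yA i; rewrite mxE.
split; first by move=> rho alpha; exact: part1.
move=> H.
(* For these values, with rho = 1, the hypothesis becomes (n + 3) / (n + 4)^2 < 1. *)
pose alpha (i : 'I_n.+2) : R := if i == ord0 then 1 else n.+4%:R.
have alpha0 i : 0 < alpha i by rewrite /alpha; case: ifP.
have B1 (f : 'I_n.+2 -> R) : (forall i, 0 < f i) -> bounded_domain (Rect 1 f).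
  by move=> f0; rewrite Rect_box; apply: bounded_domain_box => i; rewrite mulr1 invr_gt0.
have := H _ _ (B1 alpha alpha0) (B1 _ (fun i => alpha0 (tperm ord0 ord_1 i))).
apply/negP; rewrite -leNgt ltW//; apply: part1 => //.
- move=> i j ij; rewrite /alpha; case: eqP => [_|/eqP i0]; case: eqP => [j0|_] //.
    by rewrite ler1n.
  by move: ij i0; rewrite j0 leqn0 => /eqP ij; rewrite -val_eqE /= ij.
- rewrite (eq_bigr (fun=> 1 / n.+4%:R ^+ 2)); last by move=> [[|i] Hi].
  (* The n terms are counted by removing the first two from the full sum of n + 2 equal terms. *)
  have -> : \sum_(i < n.+2 | (2 <= i)%N) 1 / n.+4%:R ^+ 2 = n%:R / n.+4%:R ^+ 2 :> R.
    have : \sum_(i < n.+2) 1 / n.+4%:R ^+ 2 = n.+2%:R * (1 / n.+4%:R ^+ 2) :> R.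
      by rewrite sumr_const card_ord mulr_natl.
    rewrite sum_ord0_ord1 => /(canRL (addKr _)) ->.
    by rewrite -[n.+2]addn2 natrD; ring.
  rewrite /alpha /= expr1n divr1 -mulrDl ltr_pdivrMr ?exprn_gt0// mul1r.
  by rewrite -natrX -natrD ltr_nat -mulnn addnC addn3 leq_pmulr.
Qed.
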